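(* For every finite string $w$ over $\{0,1\}$: $\phi(w)=0$ if and only if $\#w$ is even and $\xi(w)=0$.
   Context: $\#w$ is the length of $w$, $\varepsilon$ the empty string; for $\#w\ge1$, $l(w)$ is $w$ without its last letter and $r(w)$ is $w$ without its first letter. $T^n$ is the alternating string of length $n$ starting with $0$ ($T^0=\varepsilon$, $T^n=T^{n-1}0$ for odd $n$, $T^n=T^{n-1}1$ for even $n\ge2$) and $CT^n$ its letterwise complement. $\xi:\{0,1\}^*\to\{-1,0,1\}$: $\xi(\varepsilon)=0$; $\xi(w)=1$ if $w=T^k$, $k\ge2$ even; $\xi(w)=-1$ if $w=CT^k$, $k\ge2$ even; otherwise $\xi(w)=\operatorname{sgn}(\xi(l(w))+\xi(r(w)))$. $\phi:\{0,1\}^*\to\{-1,0,1\}$: $\phi(\varepsilon)=0$; $\phi(w)=-1$ if $w=0^k$, $k$ odd; $\phi(w)=1$ if $w=1^k$, $k$ odd; otherwise $\phi(w)=\operatorname{sgn}(\phi(r(w))-\phi(l(w)))$. *)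

(* Defs.v *)
From HB Require Import structures.
From mathcomp Require Import all_boot all_order all_algebra.

Set Implicit Arguments.
Unset Strict Implicit.
Unset Printing Implicit Defensive.

Import Order.TTheory GRing.Theory Num.Theory.

Local Open Scope ring_scope.

(* Finite strings over {0,1}; the letter 0 is [false], the letter 1 is [true]. *)
Notation word := (seq bool).

(* l(w) and r(w), with the junk value [::] at [::], where they are undefined. *)
Definition dropl (w : word) : word := if w is x :: s then belast x s else [::].
Definition dropf (w : word) : word := behead w.

(* T^n and CT^n; T^(m.+1) ends in 0 when m.+1 is odd and in 1 when it is even. *)
Fixpoint alt (n : nat) : word :=
  if n is m.+1 then rcons (alt m) (odd m) else [::].

Definition calt (n : nat) : word := map negb (alt n).

(* The recursions defining xi and phi are on the length of the word, which is
   passed as the structurally decreasing argument n; n = size w suffices.  A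
   word can only equal [alt k], [calt k] or [nseq k b] for k = size w, so the
   base cases test just that k.  The defining clauses in their original form
   are the lemmas below. *)
Fixpoint xi_rec (n : nat) (w : word) : int :=
  if n is m.+1 then
    if ~~ odd (size w) && (w == alt (size w)) then 1
    else if ~~ odd (size w) && (w == calt (size w)) then -1
    else Num.sg (xi_rec m (dropl w) + xi_rec m (dropf w))
  else 0.

Definition xi (w : word) : int := xi_rec (size w) w.

Fixpoint phi_rec (n : nat) (w : word) : int :=
  if n is m.+1 then
    if odd (size w) && (w == nseq (size w) false) then -1
    else if odd (size w) && (w == nseq (size w) true) then 1
    else Num.sg (phi_rec m (dropf w) - phi_rec m (dropl w))
  else 0.

Definition phi (w : word) : int := phi_rec (size w) w.

Lemma size_dropl w : size (dropl w) = (size w).-1.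
Proof. by case: w => //= x s; rewrite size_belast. Qed.

Lemma size_dropf w : size (dropf w) = (size w).-1.
Proof. exact: size_behead. Qed.

Lemma dropl_rcons w b : dropl (rcons w b) = w.
Proof. by case: w => //= x s; rewrite belast_rcons. Qed.

Lemma dropf_cons w b : dropf (b :: w) = w.
Proof. by []. Qed.

Lemma size_alt n : size (alt n) = n.
Proof. by elim: n => //= n IHn; rewrite size_rcons IHn. Qed.

Lemma size_calt n : size (calt n) = n.
Proof. by rewrite size_map size_alt. Qed.

Lemma alt_neq_calt n : (0 < n)%N -> calt n != alt n.
Proof.
case: n => // n _; rewrite /calt /= map_rcons eqseq_rcons.
by case: (odd n); rewrite andbF.
Qed.

Lemma xi_nil : xi [::] = 0.
Proof. by []. Qed.

Lemma xi_alt k : (2 <= k)%N -> ~~ odd k -> xi (alt k) = 1.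
Proof.
move=> k2 ek; rewrite /xi size_alt.
by case: k k2 ek => // k _ ek; rewrite [xi_rec _ _]/= -/(alt k.+1) size_alt ek eqxx.
Qed.

Lemma xi_calt k : (2 <= k)%N -> ~~ odd k -> xi (calt k) = -1.
Proof.
move=> k2 ek; rewrite /xi size_calt.
have := @alt_neq_calt k (ltnW k2); case: k k2 ek => // k _ ek /negbTE ne.
by rewrite [xi_rec _ _]/= size_calt ek ne eqxx.
Qed.

Lemma xi_sgn w : w != [::] ->
  (forall k, (2 <= k)%N -> ~~ odd k -> w <> alt k) ->
  (forall k, (2 <= k)%N -> ~~ odd k -> w <> calt k) ->
  xi w = Num.sg (xi (dropl w) + xi (dropf w)).
Proof.
move=> w0 hT hC; rewrite /xi size_dropl size_dropf.
case E: (size w) => [|n]; first by rewrite (size0nil E) in w0.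
rewrite [xi_rec _ _]/=.
have n2 : ~~ odd (size w) -> (2 <= size w)%N by rewrite E; case: (n).
case: ifP => [/andP[ek /eqP e]|_]; first by case: (hT _ (n2 ek) ek).
by case: ifP => [/andP[ek /eqP e]|_] //; case: (hC _ (n2 ek) ek).
Qed.

Lemma phi_nil : phi [::] = 0.
Proof. by []. Qed.

Lemma phi_nseq0 k : odd k -> phi (nseq k false) = -1.
Proof.
move=> ok; rewrite /phi size_nseq.
by case: k ok => // k ok; rewrite [phi_rec _ _]/= size_nseq /= in ok *; rewrite ok eqxx.
Qed.

Lemma phi_nseq1 k : odd k -> phi (nseq k true) = 1.
Proof.
move=> ok; rewrite /phi size_nseq.
by case: k ok => // k ok; rewrite [phi_rec _ _]/= size_nseq /= in ok *; rewrite ok eqxx.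
Qed.

Lemma phi_sgn w : w != [::] ->
  (forall k, odd k -> w <> nseq k false) ->
  (forall k, odd k -> w <> nseq k true) ->
  phi w = Num.sg (phi (dropf w) - phi (dropl w)).
Proof.
move=> w0 h0 h1; rewrite /phi size_dropl size_dropf.
case E: (size w) => [|n]; first by rewrite (size0nil E) in w0.
rewrite [phi_rec _ _]/=.
case: ifP => [/andP[ok /eqP e]|_]; first by case: (h0 _ ok).
by case: ifP => [/andP[ok /eqP e]|_] //; case: (h1 _ ok).
Qed.

(* Main.v *)
Require Import Defs.
From mathcomp Require Import all_boot all_order all_algebra.
(* Write a word of length at least 2 as w = a m b.  Removing the outer letters
   changes phi and xi in a controlled way:
   - |w| odd: phi(w) is the sign of a if w is constant, and -phi(m) otherwise,
     so phi(w) <> 0;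
   - |w| even: phi(w) = b - a if m is constant, and -phi(m) otherwise;
   - |w| even: xi(w) = b - a if m is constant or w is alternating, and xi(m)
     otherwise; for |w| odd the same holds with "m alternating" in place of
     "w alternating".
   Each rule is proved by induction on the length, applying it to l(w) and r(w),
   whose inner words are l(m) and r(m).  If w is alternating of even length and
   m is nonempty, then xi(w) and xi(m) are both nonzero; hence on words of even
   length phi and xi vanish together, by induction on the length. *)

Import GRing.Theory Num.Theory.

Local Open Scope ring_scope.

(* All words occurring in a recursion on w are factors of w, so they are encoded
   by a position and a length in a fixed sequence f. *)
Definition window (f : nat -> bool) (i n : nat) : word := map f (iota i n).

(* The factor is constant for c = false and alternating for c = true. *)
Definition chain (f : nat -> bool) (c : bool) (i n : nat) : bool :=
  all (fun j => f j.+1 == c (+) f j) (iota i n.-1).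

(** * Chains and their end letters *)

Lemma chain_small f c i n : (n <= 1)%N -> chain f c i n.
Proof. by case: n => [|[|n]]. Qed.

Lemma chain_recl f c i n :
  chain f c i n.+2 = (f i.+1 == c (+) f i) && chain f c i.+1 n.+1.
Proof. by []. Qed.

Lemma chain_recr f c i n :
  chain f c i n.+2 = chain f c i n.+1 && (f (i + n).+1 == c (+) f (i + n)%N).
Proof. by rewrite /chain -[n.+2.-1]addn1 iotaD all_cat /= andbT. Qed.

(** Each of the [n] steps adds [c], so only the parity of [n] matters. *)
Lemma chain_nth f c i n :
  chain f c i n.+1 -> f (i + n)%N = (c && odd n) (+) f i.
Proof.
elim: n => [|n IHn]; first by rewrite addn0 andbF.
rewrite chain_recr => /andP[/IHn E /eqP]; rewrite addnS E => ->.
by case: (c); rewrite //= addNb; case: (odd n); case: (f i).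
Qed.

Lemma chain_behead f c i n : chain f c i n.+1 -> chain f c i.+1 n.
Proof. by case: n => [|n] //; rewrite chain_recl => /andP[]. Qed.

Lemma chain_belast f c i n : chain f c i n.+1 -> chain f c i n.
Proof. by case: n => [|n] //; rewrite chain_recr => /andP[]. Qed.

(** * Recognising constant and alternating windows *)

Lemma size_window f i n : size (window f i n) = n.
Proof. by rewrite size_map size_iota. Qed.

Lemma window_nth w : window (nth false w) 0 (size w) = w.
Proof. by rewrite /window -/(mkseq _ _) mkseq_nth. Qed.

Lemma dropl_window f i n : dropl (window f i n.+1) = window f i n.
Proof. by rewrite /window -addn1 iotaD cats1 map_rcons dropl_rcons. Qed.

Lemma dropf_window f i n : dropf (window f i n.+1) = window f i.+1 n.
Proof. by []. Qed.

Lemma eq_window_nseq f i n b :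
  (window f i n.+1 == nseq n.+1 b) = (f i == b) && chain f false i n.+1.
Proof.
elim: n i => [|n IHn] i; first by rewrite /= eqseq_cons.
rewrite chain_recl [window _ _ _]/= -/(window f i.+1 n.+1) [nseq _ _]/=.
rewrite eqseq_cons -[b :: _]/(nseq n.+1 b) IHn addFb.
by case: eqP => //= ->.
Qed.

(** [alt] grows at its right end; peeling letters off the left end swaps [alt] and [calt], so
    [eq_window_alt] treats both in one induction. *)
Lemma altS n : alt n.+1 = false :: calt n.
Proof.
elim: n => // n IHn; rewrite -[LHS]/(rcons (alt n.+1) (odd n.+1)) IHn.
by rewrite /calt /= map_rcons.
Qed.

Lemma caltS n : calt n.+1 = true :: alt n.
Proof. by rewrite /calt altS /= /calt mapK //; exact: negbK. Qed.

Lemma eq_window_alt f i n :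
  ((window f i n.+1 == alt n.+1) = ~~ f i && chain f true i n.+1) *
  ((window f i n.+1 == calt n.+1) = f i && chain f true i n.+1).
Proof.
elim: n i => [|n IHn] i; first by rewrite /= /calt /= !eqseq_cons; case: (f i).
rewrite chain_recl altS (caltS n.+1) [window _ _ _]/= -/(window f i.+1 n.+1).
rewrite !eqseq_cons !IHn addTb.
by case: (f i); case: (f i.+1).
Qed.

(** * The recursions of [phi] and [xi] on windows *)

Definition sign (b : bool) : int := if b then 1 else -1.

Definition step (a b : bool) : int := b%:R - a%:R.

Lemma phi_window0 f i : phi (window f i 0) = 0.
Proof. by []. Qed.

Lemma phi_windowS f i n : phi (window f i n.+1) =
  if odd n.+1 && chain f false i n.+1 then sign (f i)
  else Num.sg (phi (window f i.+1 n) - phi (window f i n)).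
Proof.
have [El Ef] := (dropl_window f i n, dropf_window f i n).
have Es := size_window f i n.+1.
have [E0 E1] := (eq_window_nseq f i n false, eq_window_nseq f i n true).
move: (window f i n.+1) El Ef Es E0 E1 => w El Ef Es E0 E1.
rewrite {1}/phi Es [phi_rec _ _]/= El Ef Es E0 E1 /phi !size_window /=.
by case: (odd n); case: (chain _ _ _ _); case: (f i).
Qed.

Lemma xi_window0 f i : xi (window f i 0) = 0.
Proof. by []. Qed.

Lemma xi_windowS f i n : xi (window f i n.+1) =
  if ~~ odd n.+1 && chain f true i n.+1 then - sign (f i)
  else Num.sg (xi (window f i n) + xi (window f i.+1 n)).
Proof.
have [El Ef] := (dropl_window f i n, dropf_window f i n).
have Es := size_window f i n.+1.
have [E0 E1] := eq_window_alt f i n.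
move: (window f i n.+1) El Ef Es E0 E1 => w El Ef Es E0 E1.
rewrite {1}/xi Es [xi_rec _ _]/= El Ef Es E0 E1 /xi !size_window /=.
by case: (odd n); case: (chain _ _ _ _); case: (f i).
Qed.

(** * Removal of both outer letters *)

Lemma phi_window_mid f i n : phi (window f i n.+2) =
  if odd n then
    if chain f false i n.+2 then sign (f i) else - phi (window f i.+1 n)
  else if chain f false i.+1 n then step (f i) (f (i + n).+1)
  else - phi (window f i.+1 n).
Proof.
elim/ltn_ind: n i => -[|[|n]] IHn i.
- rewrite !(phi_windowS, phi_window0) !chain_recl !chain_small // addn0 /=.
  by case: (f i); case: (f i.+1).
- rewrite !(phi_windowS, phi_window0) !chain_recl !chain_small // addn1 /=.
  by case: (f i); case: (f i.+1); case: (f i.+2).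
rewrite phi_windowS.
have [on|en] /= := boolP (odd n); rewrite ?on ?en ?(negbTE en) /=.
- case: ifP => // nC.
  rewrite (IHn n.+1 _ i) // (IHn n.+1 _ i.+1) //= on /=.
  rewrite [phi (window f i.+1 n.+2)]phi_windowS /= on /=.
  case: n on IHn nC => // n /= en IHn.
  (* The rule is applied once more, to l(m) and r(m): if one of them is constant, the inner words of
     both are constant, and [phi] is a [step] on each. *)
  have rule j := IHn n (ltnW (leqnSn _)) j.
  move: (rule i.+1) (rule i.+2); rewrite (negbTE en).
  have El : chain f false i.+1 n.+2 -> f (i + n).+2 = f i.+1.
    by move/chain_nth; rewrite !(addSn, addnS).
  have Er : chain f false i.+2 n.+2 -> f (i + n).+3 = f i.+2.
    by move/chain_nth; rewrite !(addSn, addnS).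
  have Ml : chain f false i.+1 n.+2 -> chain f false i.+2 n.
    by move/chain_belast/chain_behead.
  have Mr : chain f false i.+2 n.+2 -> chain f false i.+3 n.
    by move/chain_belast/chain_behead.
  have Ol : chain f false i.+1 n.+2 -> f i.+2 = f i.+1.
    by rewrite chain_recl => /andP[/eqP].
  have Or : chain f false i.+2 n.+2 -> f (i + n).+3 = f (i + n).+2.
    by rewrite chain_recr !(addSn, addnS) => /andP[_ /eqP].
  rewrite chain_recr (@chain_recl f false i n.+2).
  rewrite (@chain_recr f false i.+1 n.+1).
  rewrite !(addSn, addnS) !addFb.
  have Ml' : chain f false i.+1 n.+2 -> chain f false i.+3 n.
    by move=> /chain_behead/chain_behead.
  have Mr' : chain f false i.+2 n.+2 -> chain f false i.+2 n.
    by move=> /chain_belast/chain_belast.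
  have Tl : chain f false i.+1 n.+2 -> f (i + n).+3 = f (i + n).+2 ->
      chain f false i.+2 n.+2.
    move=> lC e; apply: chain_behead; rewrite chain_recr lC.
    by rewrite !(addSn, addnS) e eqxx.
  have [lC|nl] := boolP (chain f false i.+1 n.+2).
    have [rC|nr] := boolP (chain f false i.+2 n.+2).
      rewrite (Or rC) (El lC) eqxx andbT /= => _ _.
      by case: (f i); case: (f i.+1); case: (f (i + n).+4).
    rewrite (Ml lC) (Ml' lC) => -> -> _; move: (Tl lC).
    rewrite (negbTE nr) (El lC) (Ol lC).
    by case: (f i); case: (f i.+1); case: (f (i + n).+3) => //= /(_ erefl).
  have [rC|nr] := boolP (chain f false i.+2 n.+2); last first.
    by move=> _ _ _; rewrite -opprD sgrN.
  rewrite (Mr rC) (Mr' rC) (Er rC) => -> -> _ /=.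
  move: nl; rewrite (chain_recl f false i.+1) (chain_belast _ _ _ _ rC) andbT.
  rewrite -(Or rC) (Er rC).
  by case: (f i.+1); case: (f i.+2); case: (f (i + n).+4).
rewrite (IHn n.+1 _ i) // (IHn n.+1 _ i.+1) //= (negbTE en) /=.
rewrite [phi (window f i.+1 n.+2)]phi_windowS /= (negbTE en) /=.
rewrite (chain_recl f false i) (chain_recr f false i.+1 n.+1).
rewrite !(addSn, addnS) !addFb.
have [mC|nC] := boolP (chain f false i.+1 n.+2); last first.
  by rewrite andbF -opprD sgrN.
have Cl := chain_belast _ _ _ _ mC; have Cr := chain_behead _ _ _ _ mC.
(* For constant m, phi(l(w)) is the sign of the first letter a of w, whether or not a occurs in m;
   likewise phi(r(w)) is the sign of the last letter. *)
rewrite !phi_windowS Cl Cr andbT /= (negbTE en) /=.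
have := chain_nth _ _ _ _ mC; rewrite !(addSn, addnS) /= => ->.
move: mC; rewrite chain_recl => /andP[/eqP -> _].
by case: (f i); case: (f i.+1); case: (f (i + n).+3).
Qed.

Lemma xi_window_mid f i n : xi (window f i n.+2) =
  if chain f false i.+1 n ||
     (if odd n then chain f true i.+1 n else chain f true i n.+2)
  then step (f i) (f (i + n).+1) else xi (window f i.+1 n).
Proof.
(* Three base cases leave l(m) and r(m) with at least two letters, so that constant and alternating
   exclude each other. *)
elim/ltn_ind: n i => -[|[|[|n]]] IHn i.
- rewrite !(xi_windowS, xi_window0) !chain_recl !chain_small // addn0 /=.
  by case: (f i); case: (f i.+1).
- rewrite !(xi_windowS, xi_window0) !chain_recl !chain_small // addn1 /=.
  by case: (f i); case: (f i.+1); case: (f i.+2).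
- rewrite !(xi_windowS, xi_window0) !chain_recl !chain_small // addn2 /=.
  by case: (f i); case: (f i.+1); case: (f i.+2); case: (f i.+3).
have rl := IHn n.+2 (leqnn _) i; have rr := IHn n.+2 (leqnn _) i.+1.
have xm := xi_windowS f i.+1 n.+2.
have ml t : chain f t i.+1 n.+2 -> chain f t i.+2 n /\ chain f t i.+3 n.
  by split; [apply/chain_behead/chain_belast | apply/chain_behead/chain_behead].
have mr t : chain f t i.+2 n.+2 -> chain f t i.+2 n /\ chain f t i.+3 n.
  by split; [apply/chain_belast/chain_belast | apply/chain_behead/chain_belast].
have ends t : chain f t i.+1 n.+3 -> f (i + n).+3 = (t && odd n) (+) f i.+1.
  by move=> /chain_nth; rewrite !(addSn, addnS) /= negbK.
rewrite xi_windowS.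
have [mC|nmC] /= := boolP (chain f false i.+1 n.+3).
  have [lC rC] := (chain_belast _ _ _ _ mC, chain_behead _ _ _ _ mC).
  have mA : chain f true i.+1 n.+3 = false.
    apply/negbTE/negP; move: mC; rewrite !chain_recl => /andP[/eqP -> _].
    by rewrite addTb; case: (f i.+1).
  have wA : chain f true i n.+4.+1 = false.
    by apply/negbTE/negP => /chain_belast/chain_behead; rewrite mA.
  (* With c the letter of m, the sum telescopes: (c - a) + (b - c). *)
  rewrite wA andbF rl rr lC rC /= !(addSn, addnS) (ends _ mC) /=.
  by case: (f i); case: (f i.+1); case: (f (i + n).+4).
have [mA|nmA] := boolP (chain f true i.+1 n.+3).
  have [lA rA] := (chain_belast _ _ _ _ mA, chain_behead _ _ _ _ mA).
  have lC : chain f false i.+1 n.+2 = false.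
    apply/negbTE/negP; move: lA; rewrite !chain_recl => /andP[/eqP -> _].
    by rewrite addTb; case: (f i.+1).
  have rC : chain f false i.+2 n.+2 = false.
    apply/negbTE/negP; move: rA; rewrite !chain_recl => /andP[/eqP -> _].
    by rewrite addTb; case: (f i.+2).
  have El : f i.+2 = ~~ f i.+1.
    by move: mA; rewrite chain_recl => /andP[/eqP].
  have ec := ends _ mA.
  rewrite rl rr lC rC lA rA xm mA /=.
  rewrite (chain_recl f true i n.+3).
  rewrite [xi (window f i.+1 n.+2)]xi_windowS [xi (window f i.+2 n.+2)]xi_windowS.
  rewrite lA rA !(addSn, addnS) ec El /=.
  rewrite (chain_recl f true i n.+2).
  rewrite (chain_recr f true i.+1 n.+2) mA !(addSn, addnS) ec.
  (* For even [n] the sum is 2(b - a). For odd [n] it is xi(m) + (b - a), where b - a cancels xi(m)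
     only if w alternates. *)
  by case: (odd n); case: (f i); case: (f i.+1); case: (f (i + n).+4).
have lA : chain f true i n.+4 = false.
  by apply/negbTE/negP => /chain_behead; rewrite (negbTE nmA).
have rA : chain f true i.+1 n.+4 = false.
  by apply/negbTE/negP => /chain_belast; rewrite (negbTE nmA).
have wA : chain f true i n.+4.+1 = false.
  by apply/negbTE/negP => /chain_belast; rewrite lA.
rewrite wA andbF if_same xm (negbTE nmA) andbF.
have nm t : ~~ chain f t i.+1 n.+3 by case: t.
(* m is neither constant nor alternating, so at most one of l(m), r(m) is
   exceptional; say l(m).  Then xi(l(m)) = 0 and xi(r(m)) <> 0, so xi(r(m))
   decides the sign on both sides. *)
have excl t t' : chain f t i.+1 n.+2 -> t && ~~ odd n = false ->
    chain f t' i.+2 n.+2 -> t' && ~~ odd n = false -> False.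
  have [<- lt _ rt _|ne lt on rt on'] := eqVneq t t'.
    move/negP: (nm t); apply.
    by rewrite chain_recl rt andbT; move: lt; rewrite chain_recl => /andP[].
  (* l(m) and r(m) share two letters unless [n] is 0, and then only the constant type is allowed. *)
  case: n lt rt on on' {nmC nmA IHn rl rr xm ml mr ends lA rA wA nm}.
    by case: t t' ne => -[].
  move=> n; rewrite !chain_recl => /and3P[_ /eqP -> _] /andP[/eqP e _] _ _.
  by case: t t' ne e => -[] //; case: (f i.+2).
have special j :
    chain f false j n.+2 || (if odd n.+2 then chain f true j n.+2 else false) ->
    exists2 t, chain f t j n.+2 & t && ~~ odd n = false.
  rewrite oddS negbK -/(odd n && _).
  by case/orP=> [jC|/andP[on jA]]; [exists false | exists true; rewrite ?on].
(* Being constant or alternating of odd length, l(m) begins and ends with the same letter; the last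
   letter of m breaks its pattern. *)
have swap t : chain f t i.+1 n.+2 -> t && ~~ odd n = false ->
    [/\ f (i + n).+2 = f i.+1, f i.+2 = t (+) f i.+1 &
        f (i + n).+3 = ~~ (t (+) f i.+1)].
  move=> lt tn; have := chain_nth _ _ _ _ lt; have := nm t.
  rewrite chain_recr lt !(addSn, addnS) /= tn /= => ne e.
  split=> //; first by move: lt; rewrite chain_recl => /andP[/eqP].
  by move: ne; rewrite e; case: (f (i + n).+3); case: (t); case: (f i.+1).
have swap' t : chain f t i.+2 n.+2 -> t && ~~ odd n = false ->
    [/\ f (i + n).+3 = f i.+2, f (i + n).+2 = t (+) f i.+2 &
        f i.+1 = ~~ (t (+) f i.+2)].
  move=> rt tn; have := chain_nth _ _ _ _ rt; have := nm t.
  rewrite chain_recl rt !(addSn, addnS) /= tn /= => ne e.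
  move: rt; rewrite chain_recr !(addSn, addnS) e => /andP[_ /eqP rt].
  split=> //; first by rewrite rt; case: (t); case: (f _).
  by move: ne; case: (f i.+2); case: (t); case: (f i.+1).
have mid t j : chain f t j.+1 n -> t && ~~ odd n = false ->
    xi (window f j n.+2) = step (f j) (f (j + n).+1).
  rewrite IHn; last exact: ltnW.
  by case: t => [jA /negbFE -> | -> //]; rewrite jA orbT.
rewrite {}rl {}rr lA rA !(addSn, addnS).
case: ifP => [/special[t lt tn]|_].
  case: ifP => [/special[t' rt tn']|_]; first by case: (excl _ _ lt tn rt tn').
  (* l(w) and r(m) end in the same letter, so xi(l(w)) is 0 or equals xi(r(m)). *)
  have [/mid -> // /mid -> //] := ml t lt.
  have [] := swap t lt tn; rewrite !(addSn, addnS) => -> -> ->.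
  by case: (t); case: (f i); case: (f i.+1).
case: ifP => [/special[t rt tn]|_ //].
have [/mid -> // /mid -> //] := mr t rt.
have [] := swap' t rt tn; rewrite !(addSn, addnS) => -> -> ->.
by case: (t); case: (f (i + n).+4); case: (f i.+2).
Qed.

(** * Comparison of the zeros *)

Lemma phi_window_odd f i n : odd n -> phi (window f i n) != 0.
Proof.
elim/ltn_ind: n i => -[|[|n]] // IHn i.
  by rewrite phi_windowS chain_small //; case: (f i).
rewrite /= negbK => on; rewrite phi_window_mid on.
by case: ifP => _; [case: (f i) | rewrite oppr_eq0; exact: IHn].
Qed.

Lemma phi_xi_window_even f i n : ~~ odd n ->
  (phi (window f i n) == 0) = (xi (window f i n) == 0).
Proof.
elim/ltn_ind: n i => -[|[|n]] // IHn i; rewrite /= negbK => en.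
rewrite phi_window_mid xi_window_mid (negbTE en).
have [|nC] /= := boolP (chain f false i.+1 n); first by [].
have [wA|_] := boolP (chain f true i n.+2); last by rewrite oppr_eq0 IHn.
rewrite oppr_eq0 IHn //.
have := chain_nth _ _ _ _ wA; rewrite addnS /= en => ->.
(* m is nonempty here, since the empty window counts as constant. *)
case: n en nC wA {IHn} => // n en _ /chain_belast/chain_behead mA.
by rewrite xi_windowS mA en /=; case: (f i); case: (f i.+1).
Qed.

Theorem theorem4p2 (w : word) :
  phi w = 0 <-> ~~ odd (size w) /\ xi w = 0.
Proof.
have [ow|ew] := boolP (odd (size w)).
  have /eqP := phi_window_odd (nth false w) 0 _ ow.
  by rewrite window_nth; split=> // -[].
have := phi_xi_window_even (nth false w) 0 _ ew; rewrite window_nth => E.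
by split=> [/eqP|[_ /eqP]]; [rewrite E => /eqP | rewrite -E => /eqP].
Qed.
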